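(* Let $N, W, M$ be positive integers, $L=1$, and $\mathbf{w}\in\mathbb{C}^W$ a window such that (i) $\mathbf{w}$ is non-vanishing ($w[n]\neq0$ for $0\le n\le W-1$); (ii) $2\le W\le \frac{N}{2}$; (iii) $4\le M\le N$. Then for almost all non-vanishing $\mathbf{x}_0\in\mathbb{C}^N$ (all $\mathbf{x}_0$ with every entry nonzero, except a Lebesgue-null set), the only $N\times N$ Hermitian positive semidefinite matrix $\mathbf{X}$ satisfying $$\operatorname{trace}(\mathbf{W}_r^\star\mathbf{f}_m\mathbf{f}_m^\star\mathbf{W}_r\mathbf{X})=Z_w[m,r]\quad\text{for all }1\le m\le M,\ 0\le r\le R-1$$ is $\mathbf{X}_0=\mathbf{x}_0\mathbf{x}_0^\star$. In particular, the semidefinite program minimizing $\operatorname{trace}(\mathbf{X})$ subject to these constraints and $\mathbf{X}\succeq0$ has the unique feasible (hence optimal) point $\mathbf{x}_0\mathbf{x}_0^\star$.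
   Context: The window is extended by $w[k]=0$ for $k\notin\{0,\dots,W-1\}$; with $L=1$, $R=\lceil (N+W-1)/L\rceil=N+W-1$. For $0\le r\le R-1$, $\mathbf{W}_r$ is the $N\times N$ diagonal matrix with diagonal entries $w[rL-n]$, $n=0,\dots,N-1$. For integer $m$, $\mathbf{f}_m\in\mathbb{C}^N$ has entries $f_m[n]=e^{i2\pi mn/N}$ (indices modulo $N$), and $\star$ denotes conjugate transpose. The measurements are the STFT magnitudes of $\mathbf{x}_0$: $Z_w[m,r]=|\mathbf{f}_m^\star\mathbf{W}_r\mathbf{x}_0|^2=\big|\sum_{n=0}^{N-1}x_0[n]w[rL-n]e^{-i2\pi mn/N}\big|^2$. *)

(* Defs.v *)
From mathcomp Require Import all_boot all_algebra.
From mathcomp Require Import reals trigo complex.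
Set Implicit Arguments. Unset Strict Implicit. Unset Printing Implicit Defensive.
Import GRing.Theory Num.Theory.
Local Open Scope ring_scope.

Section STFT.
Variable R : realType.
Local Notation C := R[i].

Definition ctr m n (A : 'M[C]_(m, n)) : 'M[C]_(n, m) := (map_mx (@conjc R) A)^T.

Definition wext W (w : 'I_W -> C) (k : int) : C :=
  match k with
  | Posz n => if @insub nat (fun j => j < W)%N _ n is Some i then w i else 0
  | Negz _ => 0
  end.

Definition Wmat N W (w : 'I_W -> C) (r : nat) : 'M[C]_N :=
  diag_mx (\row_(n < N) wext w (r%:Z - (n : nat)%:Z)).

Definition fvec N (m : nat) : 'cV[C]_N :=
  \col_(n < N) (cos (2 * pi * (m * n)%:R / N%:R) +i* sin (2 * pi * (m * n)%:R / N%:R))%C.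

Definition Zw N W (w : 'I_W -> C) (x0 : 'cV[C]_N) (m r : nat) : C :=
  `|(ctr (fvec N m) *m Wmat N w r *m x0) 0 0| ^+ 2.

Definition hpsd N (X : 'M[C]_N) : Prop :=
  ctr X = X /\ forall v : 'cV[C]_N, 0 <= (ctr v *m X *m v) 0 0.

Definition stft_feasible N W M (w : 'I_W -> C) (x0 : 'cV[C]_N) (X : 'M[C]_N) : Prop :=
  forall m r : nat, (1 <= m <= M)%N -> (r < N + W - 1)%N ->
    \tr (ctr (Wmat N w r) *m fvec N m *m ctr (fvec N m) *m Wmat N w r *m X)
    = Zw w x0 m r.

(* Lebesgue-null subset of C^N (identified with R^{2N}): for every eps > 0
   it is covered by countably many boxes of total volume <= eps. *)
Definition cnull N (E : 'cV[C]_N -> Prop) : Prop :=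
  forall eps : R, 0 < eps ->
  exists a b c d : nat -> 'I_N -> R,
    (forall k i, a k i <= b k i /\ c k i <= d k i) /\
    (forall x, E x -> exists k, forall i,
        a k i <= complex.Re (x i 0) <= b k i /\ c k i <= complex.Im (x i 0) <= d k i) /\
    (forall K : nat,
        \sum_(k < K) \prod_(i < N) ((b k i - a k i) * (d k i - c k i)) <= eps).

End STFT.

(* Main.v *)
Require Import Defs.
From mathcomp Require Import all_boot all_order all_algebra.
From mathcomp Require Import reals trigo complex.
From mathcomp Require Import ring lra.
Import Order.TTheory GRing.Theory Num.Theory.
Local Open Scope ring_scope.

(* Let D = X - x0 x0^*. The measurement at [(m, r)] says y D y^* = 0, where the
   row vector y = f_m^* W_r is supported in [r-W+1, r]. Inductively D vanishes on
   the indices < r; then X has a rank one block there, and positivity forces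
   D n r = c x0[n] for n < r. The measurements at r read T + 2 Re (C g_m) = 0 with
   T = |w[0]|^2 D r r, C = c conj w[0] and
   g_m = sum_(n < r) x0[n] w[r-n] e^(2 i pi m (r-n) / N). If g_1, g_2, g_3 do not
   lie on a real line this gives C = 0, then T = 0. Collinearity of the g_m is a
   real quadratic equation in x0, whose leading coefficient in x0[r-1] is
   |w[1]|^2 times the oriented area spanned by three distinct points of the unit
   circle, so it is nonzero; such a quadric is a union of two graphs and is null. *)

(** * Countable covers by boxes *)

Section NullSets.
Context {R : realType} {I : finType}.
Implicit Types (E : (I -> R) -> Prop) (x y : I -> R).

(** The notion [cnull] over any finite index type, so that C^N becomes R^(2N) indexed by
    ['I_N * bool]. Volumes being nonnegative, a bound on all partial sums bounds the whole
    series. *)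
Definition box_null E : Prop :=
  forall eps : R, 0 < eps ->
  exists a b : nat -> I -> R,
    (forall k i, a k i <= b k i) /\
    (forall x, E x -> exists k, forall i, a k i <= x i <= b k i) /\
    (forall K : nat, \sum_(k < K) \prod_i (b k i - a k i) <= eps).

Lemma box_null_sub {E E'} : (forall x, E x -> E' x) -> box_null E' -> box_null E.
Proof.
move=> sEE' nE' e e0; have [a [b [ab [cov sm]]]] := nE' e e0.
by exists a, b; split=> //; split=> // x /sEE' /cov.
Qed.

Lemma prod_side_ge0 (a b : I -> R) :
  (forall i, a i <= b i) -> 0 <= \prod_i (b i - a i).
Proof. by move=> ab; apply: prodr_ge0 => i _; rewrite subr_ge0. Qed.

(** Boxes are renumbered along [pickle_inv]. Numbers that code no element get the one-point box at
    0, whose volume is 0 because the index [i0] contributes a zero factor; over an empty [I] the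
    product would be 1. *)
Lemma box_cover_count (i0 : I) E (eps : R) (T : countType) (a b : T -> I -> R) :
  0 < eps -> (forall t i, a t i <= b t i) ->
  (forall x, E x -> exists t, forall i, a t i <= x i <= b t i) ->
  (forall s : seq T, uniq s -> \sum_(t <- s) \prod_i (b t i - a t i) <= eps) ->
  exists a' b' : nat -> I -> R,
    (forall k i, a' k i <= b' k i) /\
    (forall x, E x -> exists k, forall i, a' k i <= x i <= b' k i) /\
    (forall K : nat, \sum_(k < K) \prod_i (b' k i - a' k i) <= eps).
Proof.
move=> eps0 ab cov sm.
pose f (c : T -> I -> R) k i := if @pickle_inv T k is Some t then c t i else 0.
exists (f a), (f b); split; first by move=> k i; rewrite /f; case: pickle_inv.
split=> [x /cov [t xt]|K].
  by exists (pickle t) => i; rewrite /f pickleK_inv.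
have -> : \sum_(k < K) \prod_i (f b k i - f a k i) =
   \sum_(t <- pmap (@pickle_inv T) (iota 0 K)) \prod_i (b t i - a t i).
  rewrite -(big_mkord xpredT (fun k => \prod_i (f b k i - f a k i))) /index_iota subn0.
  elim: (iota 0 K) => [|k s IH]; first by rewrite !big_nil.
  rewrite big_cons IH /= /f; case: (pickle_inv k) => [t|] /=; first by rewrite big_cons.
  by rewrite (bigD1 i0) //= subrr mul0r add0r.
apply: sm; apply: (pmap_uniq (@pickle_invK T)); exact: iota_uniq.
Qed.

Lemma ler_sum_sub_seq (T : eqType) (s s' : seq T) (v : T -> R) :
  uniq s -> {subset s <= s'} -> (forall t, 0 <= v t) ->
  \sum_(t <- s) v t <= \sum_(t <- s') v t.
Proof.
move=> us ss' v0; elim: s s' us ss' => [|t s IH] s'; first by rewrite big_nil sumr_ge0.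
move=> /= /andP[ts us] ss'; have ts' := ss' t (mem_head _ _).
rewrite big_cons (big_rem t ts') /= lerD2l; apply: IH => // u us1.
have : u \in s' by apply: ss'; rewrite inE us1 orbT.
rewrite (perm_mem (perm_to_rem ts')) inE => /predU1P[ut|//].
by move: ts; rewrite -ut us1.
Qed.

Lemma sum_half_powers_le1 K : \sum_(k < K) (2^-1 : R) ^+ k.+1 <= 1.
Proof.
suff -> : \sum_(k < K) (2^-1 : R) ^+ k.+1 = 1 - 2^-1 ^+ K.
  by rewrite gerBl exprn_ge0 ?invr_ge0 ?ler0n.
elim: K => [|K IH]; first by rewrite big_ord0 expr0 subrr.
by rewrite big_ord_recr /= IH exprS; lra.
Qed.

(** The set of index j is covered with total volume at most eps / 2^(j+1), and all these boxes
    together are indexed by pairs. *)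
Lemma box_null_bigcup (i0 : I) (E : nat -> (I -> R) -> Prop) :
  (forall j, box_null (E j)) -> box_null (fun x => exists j, E j x).
Proof.
move=> nE eps eps0.
have ex j : exists ab : (nat -> I -> R) * (nat -> I -> R),
  [/\ forall k i, ab.1 k i <= ab.2 k i,
      forall x, E j x -> exists k, forall i, ab.1 k i <= x i <= ab.2 k i &
      forall K, \sum_(k < K) \prod_i (ab.2 k i - ab.1 k i) <= eps * 2^-1 ^+ j.+1].
  have [|a [b [ab [cov sm]]]] := nE j (eps * 2^-1 ^+ j.+1).
    by rewrite mulr_gt0 ?exprn_gt0 ?invr_gt0.
  by exists (a, b).
have [c cP] := boolp.choice ex.
apply: (@box_cover_count i0 _ _ (nat * nat)%type
          (fun t => (c t.1).1 t.2) (fun t => (c t.1).2 t.2)) => //.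
- by move=> [j k] i; have [ab _ _] := cP j; apply: ab.
- move=> x [j Ex]; have [_ cov _] := cP j; have [k kP] := cov x Ex.
  by exists (j, k).
move=> s us.
have v0 t : 0 <= \prod_i ((c t.1).2 t.2 i - (c t.1).1 t.2 i).
  by apply: prod_side_ge0 => i; have [ab _ _] := cP t.1; apply: ab.
(* A finite set of pairs lies in a square of side [K], where the sum can be taken row by row. *)
pose K := (\max_(t <- s) maxn t.1 t.2).+1.
have sub : {subset s <= allpairs pair (iota 0 K) (iota 0 K)}.
  move=> t ts; have : (maxn t.1 t.2 < K)%N by rewrite ltnS;
    apply: (@leq_bigmax_seq _ s xpredT (fun t => maxn t.1 t.2)).
  rewrite gtn_max => /andP[t1 t2].
  by apply/allpairsP; exists t; rewrite !mem_iota t1 t2; split=> //; case: (t).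
apply: le_trans (ler_sum_sub_seq _ _ _ _ us sub v0) _.
rewrite big_allpairs /=.
apply: le_trans (_ : \sum_(j <- iota 0 K) eps * 2^-1 ^+ j.+1 <= _).
  apply: ler_sum => j _; have [_ _ /(_ K)] := cP j.
  rewrite -(big_mkord xpredT (fun k => \prod_i ((c j).2 k i - (c j).1 k i))).
  by rewrite /index_iota subn0.
have -> : iota 0 K = index_iota 0 K by rewrite /index_iota subn0.
rewrite big_mkord -mulr_sumr ger_pMr //; exact: sum_half_powers_le1.
Qed.

End NullSets.

(** * Null sets of real quadrics *)

Section UniformlyContinuous.
Context {R : realType} {I : finType}.
Implicit Types (F G : (I -> R) -> R) (x y : I -> R).

(** Continuity in the form that compactness of cubes would give, here obtained by direct estimates.
    The bound on [F] is what makes the class stable under products. *)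
Definition unif_cont_bdd F : Prop := forall B : R,
  (exists M, forall x, (forall i, `|x i| <= B) -> `|F x| <= M) /\
  (forall eps : R, 0 < eps -> exists2 delta : R, 0 < delta & forall x y,
     (forall i, `|x i| <= B) -> (forall i, `|y i| <= B) ->
     (forall i, `|x i - y i| <= delta) -> `|F x - F y| <= eps).

Lemma ucb_cst (c : R) : unif_cont_bdd (fun=> c).
Proof.
move=> B; split; first by exists `|c|.
by move=> e e0; exists 1 => // *; rewrite subrr normr0 ltW.
Qed.

Lemma ucb_coord i : unif_cont_bdd (fun x => x i).
Proof.
by move=> B; split; [exists B => x | move=> e e0; exists e].
Qed.

Lemma ucbD {F G} : unif_cont_bdd F -> unif_cont_bdd G ->
  unif_cont_bdd (fun x => F x + G x).
Proof.
move=> uF uG B; have [[M FM] cF] := uF B; have [[M' GM] cG] := uG B; split.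
  exists (M + M') => x xB; apply: le_trans (ler_normD _ _) _.
  by apply: lerD; [apply: FM | apply: GM].
move=> e e0; have e20 : 0 < e / 2 by lra.
have [d d0 dF] := cF _ e20; have [d' d'0 dG] := cG _ e20.
exists (Num.min d d') => [|x y xB yB xy]; first by rewrite lt_min d0.
have -> : F x + G x - (F y + G y) = (F x - F y) + (G x - G y) by ring.
apply: le_trans (ler_normD _ _) _; rewrite [leRHS](splitr e); apply: lerD.
  by apply: dF => // i; have := xy i; rewrite le_min => /andP[].
by apply: dG => // i; have := xy i; rewrite le_min => /andP[].
Qed.

Lemma ucbM {F G} : unif_cont_bdd F -> unif_cont_bdd G ->
  unif_cont_bdd (fun x => F x * G x).
Proof.
move=> uF uG B; have [[M FM] cF] := uF B; have [[M' GM] cG] := uG B; split.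
  exists (M * M') => x xB; rewrite normrM.
  by apply: ler_pM => //; [apply: FM | apply: GM].
(* One positive constant above both bounds, so that each half of the product estimate costs e /
   2. *)
pose L := `|M| + `|M'| + 1.
have L0 : 0 < L by rewrite ltr_wpDl // addr_ge0.
move=> e e0; have e20 : 0 < e / 2 / L by rewrite divr_gt0 //; lra.
have [d d0 dF] := cF _ e20; have [d' d'0 dG] := cG _ e20.
exists (Num.min d d') => [|x y xB yB xy]; first by rewrite lt_min d0.
have -> : F x * G x - F y * G y = (F x - F y) * G x + F y * (G x - G y) by ring.
have LM : M <= L by have := ler_norm M; have := normr_ge0 M'; rewrite /L; lra.
have LM' : M' <= L by have := ler_norm M'; have := normr_ge0 M; rewrite /L; lra.
have fx : `|F x - F y| <= e / 2 / L.
  by apply: dF => // i; have := xy i; rewrite le_min => /andP[].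
have gx : `|G x - G y| <= e / 2 / L.
  by apply: dG => // i; have := xy i; rewrite le_min => /andP[].
have eL : e / 2 = e / 2 / L * L by rewrite divfK // gt_eqF.
apply: le_trans (ler_normD _ _) _; rewrite [leRHS](splitr e) !normrM; apply: lerD.
  by rewrite eL; apply: ler_pM => //; apply: le_trans LM'; apply: GM.
by rewrite mulrC eL; apply: ler_pM => //; apply: le_trans LM; apply: FM.
Qed.

Lemma ucb_sum (J : Type) (s : seq J) (P : pred J) (F : J -> (I -> R) -> R) :
  (forall j, unif_cont_bdd (F j)) -> unif_cont_bdd (fun x => \sum_(j <- s | P j) F j x).
Proof.
move=> uF; elim: s => [|j s IH].
  by congr unif_cont_bdd: (ucb_cst 0); apply: boolp.funext => x; rewrite big_nil.
have : unif_cont_bdd (fun x => (if P j then F j x else 0) + \sum_(j <- s | P j) F j x).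
  by apply: ucbD => //; case: (P j) => //; apply: ucb_cst.
by congr unif_cont_bdd; apply: boolp.funext => x; rewrite big_cons; case: ifP => //; rewrite add0r.
Qed.

(* No sign condition on [a] and [b]: [Num.sqrt] is [0] on negative numbers. *)
Lemma sqrt_le_sqrtD (a b e : R) :
  0 <= e -> a <= b + e ^+ 2 -> Num.sqrt a <= Num.sqrt b + e.
Proof.
move=> e0 ab; have s0 := sqrtr_ge0 b.
have bs : b <= Num.sqrt b ^+ 2.
  by case: (lerP 0 b) => [/sqr_sqrtr ->//|/ltW b0]; apply: le_trans b0 _; rewrite sqr_ge0.
rewrite -[leRHS]ger0_norm ?addr_ge0 // -sqrtr_sqr; apply: ler_wsqrtr.
have := mulr_ge0 s0 e0; rewrite sqrrD; lra.
Qed.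

(** The square root is Hölder of exponent 1/2 with constant 1: a variation of [F] by at most e^2
    moves the root by at most e. *)
Lemma ucb_sqrt {F} : unif_cont_bdd F -> unif_cont_bdd (fun x => Num.sqrt (F x)).
Proof.
move=> uF B; have [[M FM] cF] := uF B; split.
  exists (Num.sqrt M) => x xB; rewrite ger0_norm ?sqrtr_ge0 //; apply: ler_wsqrtr.
  exact: le_trans (ler_norm _) (FM x xB).
move=> e e0; have [d d0 dF] := cF _ (exprn_gt0 2 e0).
exists d => // x y xB yB xy; have := dF x y xB yB xy.
rewrite !ler_norml => /andP[h1 h2].
have := @sqrt_le_sqrtD (F x) (F y) e (ltW e0).
have := @sqrt_le_sqrtD (F y) (F x) e (ltW e0); lra.
Qed.

Lemma ucb_linear (l : I -> R) (P : pred I) : unif_cont_bdd (fun x => \sum_(i | P i) l i * x i).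
Proof. by apply: ucb_sum => i; apply: ucbM; [apply: ucb_cst | apply: ucb_coord]. Qed.

(* On a bounded cube, the grid cells meeting the graph lie in boxes which are
   short in direction [i0]; the cells [f] with [f i0 != 0] are redundant and get
   boxes of width 0, so that the total volume factors as a product over [I]. *)
Lemma graph_box_null i0 (F : (I -> R) -> R) : unif_cont_bdd F ->
  (forall x y, (forall i, i != i0 -> x i = y i) -> F x = F y) ->
  box_null (fun x => x i0 = F x).
Proof.
move=> uF Fi0.
(* The graph is the countable union of its parts in the cubes of half-side k + 1. *)
apply: (box_null_sub (E' := fun x =>
  exists k : nat, (forall i, `|x i| <= k.+1%:R) /\ x i0 = F x)).
  move=> x xF; exists (\sum_i Num.bound (x i))%N; split=> // i.
  have := archi_boundP (normr_ge0 (x i)).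
  rewrite (eqP (_ : Num.bound `|x i| == Num.bound (x i))); last by rewrite /Num.bound normr_id.
  move=> /ltW /le_trans; apply; rewrite ler_nat leqW // (bigD1 i) //= leq_addr //.
apply: (box_null_bigcup i0) => k eps eps0.
set B : R := k.+1%:R; have B0 : 0 < B by rewrite ltr0n.
(* In each direction other than [i0] the m + 1 cells have total length 2 B + h <= 4 B. In direction
   [i0] the length is 2 eta, and [eta] is chosen so that 2 eta V = eps. *)
pose V : R := \prod_(i | i != i0) (4 * B).
have V0 : 0 < V by apply: prodr_gt0 => i _; lra.
pose eta := eps / 2 / V.
have eta0 : 0 < eta by rewrite divr_gt0 //; lra.
have [_ /(_ _ eta0) [d d0 dF]] := uF B.
pose m := (Num.bound (2 * B / d)).+1.
pose h := 2 * B / m%:R.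
have m0 : 0 < (m%:R : R) by rewrite ltr0n.
have h0 : 0 < h by rewrite divr_gt0 //; lra.
have mh : m%:R * h = 2 * B by rewrite /h mulrC divfK // gt_eqF.
have hd : h <= d.
  rewrite ler_pdivrMr // [d * _]mulrC -ler_pdivrMr //.
  have : 0 <= 2 * B / d by rewrite divr_ge0 ?ltW //; lra.
  by move=> /archi_boundP/ltW/le_trans; apply; rewrite ler_nat.
(* The index type is ['I_m.+1] and not ['I_m] because the endpoint x i = B has cell number m. *)
pose c (f : {ffun I -> 'I_m.+1}) i : R := - B + (f i)%:R * h.
pose lo (f : {ffun I -> 'I_m.+1}) i :=
  if i == i0 then if f i0 == ord0 then F (c f) - eta else 0 else c f i.
pose hi (f : {ffun I -> 'I_m.+1}) i :=
  if i == i0 then if f i0 == ord0 then F (c f) + eta else 0 else c f i + h.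
apply: (@box_cover_count _ _ i0 _ _ _ lo hi) => //.
- move=> f i; rewrite /lo /hi; case: ifP => _; last by rewrite lerDl ltW.
  by case: ifP => // _; lra.
- move=> x [xB xF].
  pose f := [ffun i => if i == i0 then ord0 : 'I_m.+1 else inord (Num.truncn ((x i + B) / h))].
  have fP i : i != i0 -> c f i <= x i <= c f i + h.
    move=> ii0; rewrite /c ffunE (negbTE ii0).
    have := xB i; rewrite ler_norml => /andP[x1 x2].
    have q0 : 0 <= (x i + B) / h by rewrite divr_ge0 ?(ltW h0) //; lra.
    have /andP[t1 t2] := truncn_itv q0.
    rewrite inordK; last first.
      by rewrite truncn_lt_nat // ltr_pdivrMr // -natr1 mulrDl mh; lra.
    move: t1 t2; rewrite ler_pdivlMr // ltr_pdivrMr // -natr1 mulrDl; lra.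
  have cB i : `|c f i| <= B.
    rewrite /c ler_norml; have fi : 0 <= (f i)%:R * h by rewrite mulr_ge0 ?(ltW h0).
    have : (f i)%:R * h <= m%:R * h by rewrite ler_pM2r // ler_nat -ltnS.
    rewrite mh; lra.
  (* [F] ignores the coordinate [i0], so it may be reset to - B, which is the value of [c f] there;
     then x' and [c f] are within h <= d of each other. *)
  pose x' i := if i == i0 then - B else x i.
  have xx' : F x = F x' by apply: Fi0 => i /negbTE; rewrite /x' => ->.
  have x'B i : `|x' i| <= B by rewrite /x'; case: ifP => // _; rewrite normrN ger0_norm // ltW.
  exists f => i; rewrite /lo /hi; case: (boolP (i == i0)) => [/eqP->|/fP //].
  rewrite {1 2}/f ffunE !eqxx xF xx'.
  have : `|F x' - F (c f)| <= eta.
    apply: dF => // j; rewrite /x'; case: (boolP (j == i0)) => [/eqP->|/fP].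
      by rewrite /c ffunE eqxx mul0r addr0 subrr normr0 ltW.
    by move=> /andP[c1 c2]; rewrite ger0_norm; lra.
  by rewrite ler_norml; lra.
move=> s us.
pose ell i (j : 'I_m.+1) : R :=
  if i == i0 then if j == ord0 then eta * 2 else 0 else h.
have lohi f : \prod_i (hi f i - lo f i) = \prod_i ell i (f i).
  apply: eq_bigr => i _; rewrite /hi /lo /ell.
  case: eqP => [->|_]; last by ring.
  by case: ifP => _; ring.
apply: le_trans (_ : \sum_(f : {ffun I -> 'I_m.+1}) \prod_i ell i (f i) <= _).
  under eq_bigr do rewrite lohi.
  apply: ler_sum_sub_seq => // [f _|f]; first by rewrite mem_index_enum.
  apply: prodr_ge0 => i _; rewrite /ell; do !case: ifP => _ //; last exact: ltW.
  by rewrite mulr_ge0 // ltW.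
rewrite -bigA_distr_bigA (bigD1 i0) //=.
have -> : \sum_(j < m.+1) ell i0 j = eta * 2.
  by rewrite /ell eqxx (bigD1 ord0) //= big1 ?addr0 // => j /negbTE ->.
have -> : eps = eta * 2 * V.
  by rewrite /eta; field; rewrite gt_eqF.
rewrite ler_pM2l; last by rewrite mulr_gt0.
apply: ler_prod => i /negbTE ii0; rewrite /ell ii0 sumr_const card_ord.
rewrite mulrn_wge0 ?(ltW h0) //= mulrSr -[h *+ m]mulr_natl mh.
have : h <= 2 * B by rewrite -mh ler_peMl ?(ltW h0) // ler1n.
lra.
Qed.

(* Every point of the set lies on one of the two graphs given by the quadratic
   formula in the coordinate [i0]. *)
Lemma quadric_box_null i0 (l1 l2 l3 l4 : I -> R) :
  l1 i0 * l2 i0 - l3 i0 * l4 i0 != 0 ->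
  box_null (fun x => (\sum_i l1 i * x i) * (\sum_i l2 i * x i) -
                     (\sum_i l3 i * x i) * (\sum_i l4 i * x i) = 0).
Proof.
set a := _ - _ => a0.
pose r (l : I -> R) x := \sum_(i | i != i0) l i * x i.
(* The coefficients of the quadric as a polynomial a t^2 + b t + c in t = x i0. Differences are
   written with -1 as a factor so that [ucbD] and [ucbM] apply. *)
pose b x := l1 i0 * r l2 x + l2 i0 * r l1 x + (-1) * (l3 i0 * r l4 x + l4 i0 * r l3 x).
pose c x := r l1 x * r l2 x + (-1) * (r l3 x * r l4 x).
pose disc x := b x * b x + (- (4 * a)) * c x.
pose F (s : bool) x := ((-1) ^+ s * Num.sqrt (disc x) + (-1) * b x) * (2 * a)^-1.
have ur l : unif_cont_bdd (r l) by apply: ucb_linear.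
have ucZ k G : unif_cont_bdd G -> unif_cont_bdd (fun x => k * G x).
  exact/ucbM/ucb_cst.
have ub : unif_cont_bdd b.
  apply: (ucbD (ucbD (ucZ _ _ (ur l2)) (ucZ _ _ (ur l1)))).
  exact: (ucZ _ _ (ucbD (ucZ _ _ (ur l4)) (ucZ _ _ (ur l3)))).
have uc : unif_cont_bdd c.
  by apply: (ucbD (ucbM (ur l1) (ur l2)) (ucZ _ _ (ucbM (ur l3) (ur l4)))).
have uF s : unif_cont_bdd (F s).
  apply: (ucbM (ucbD (ucZ _ _ (ucb_sqrt (ucbD (ucbM ub ub) (ucZ _ _ uc)))) (ucZ _ _ ub))).
  exact: ucb_cst.
have Fi0 s x y : (forall i, i != i0 -> x i = y i) -> F s x = F s y.
  move=> xy; have rE l : r l x = r l y by apply: eq_bigr => i /xy ->.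
  by rewrite /F /disc /b /c !rE.
(* Unions are indexed by [nat], so the parity of j selects the sign of the root. *)
apply: (box_null_sub (E' := fun x => exists j : nat, x i0 = F (odd j) x)); last first.
  by apply: (box_null_bigcup i0) => j; apply: graph_box_null; [apply: uF | apply: Fi0].
move=> x; have lE l : \sum_i l i * x i = l i0 * x i0 + r l x by rewrite (bigD1 i0).
rewrite !lE; set t := x i0 => H.
have q : (2 * a * t + b x) ^+ 2 = disc x.
  have : a * t ^+ 2 + b x * t + c x = 0 by rewrite -[RHS]H /a /b /c; ring.
  move=> /(congr1 (fun z => 4 * a * z)); rewrite mulr0 => q0; apply/eqP.
  by rewrite -subr_eq0 -[X in _ == X]q0; apply/eqP; rewrite /disc; ring.
have [s sE] : exists s : bool,
    (-1) ^+ s * Num.sqrt (disc x) = 2 * a * t + b x.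
  rewrite -q sqrtr_sqr; case: (lerP 0 (2 * a * t + b x)) => z.
    by exists false; rewrite expr0 mul1r ger0_norm.
  by exists true; rewrite expr1 ltr0_norm // mulrNN mul1r.
exists (s : nat); rewrite oddb /F sE; field.
exact: a0.
Qed.

End UniformlyContinuous.

(** * Complex coordinates and Hermitian matrices *)

Lemma big_pair_bool (T : Type) (idx : T) (op : Monoid.com_law idx) (I : finType)
    (F : I * bool -> T) :
  \big[op/idx]_p F p = \big[op/idx]_i op (F (i, true)) (F (i, false)).
Proof.
rewrite (eq_bigr (fun p => F (p.1, p.2))) => [|[]//].
rewrite -(pair_bigA _ (fun i s => F (i, s))) /=.
by apply: eq_bigr => i _; rewrite big_bool.
Qed.

Section ComplexNull.
Context {R : realType} {N : nat}.
Local Notation C := R[i].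

Definition re_im (x : 'cV[C]_N) (p : 'I_N * bool) : R :=
  if p.2 then complex.Im (x p.1 0) else complex.Re (x p.1 0).

Lemma box_null_cnull (E : ('I_N * bool -> R) -> Prop) :
  box_null E -> cnull (fun x => E (re_im x)).
Proof.
move=> nE e e0; have [a [b [ab [cov sm]]]] := nE e e0.
exists (fun k i => a k (i, false)), (fun k i => b k (i, false)),
       (fun k i => a k (i, true)), (fun k i => b k (i, true)).
split; first by move=> k i; split; apply: ab.
split=> [x /cov[k xk]|K].
  by exists k => i; split; [apply: (xk (i, false)) | apply: (xk (i, true))].
apply: le_trans (sm K); rewrite le_eqVlt; apply/orP; left; apply/eqP.
apply: eq_bigr => k _; rewrite big_pair_bool; apply: eq_bigr => i _.
by rewrite mulrC.
Qed.

(** This is the oriented area spanned by A and B in the real plane, which vanishes exactly when they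
    lie on one real line through 0. *)
Lemma Im_conjM (A B : C) :
  complex.Im (conjc A * B) = complex.Re A * complex.Im B - complex.Im A * complex.Re B.
Proof. by case: A B => [a1 a2] [b1 b2] /=; ring. Qed.

Lemma Re_sumM (z : 'I_N -> C) (x : 'cV[C]_N) :
  complex.Re (\sum_i z i * x i 0) =
  \sum_p (if p.2 then - complex.Im (z p.1) else complex.Re (z p.1)) * re_im x p.
Proof.
rewrite big_pair_bool raddf_sum /=; apply: eq_bigr => i _; rewrite /re_im /=.
by case: (z i) (x i 0) => [a b] [c d] /=; ring.
Qed.

Lemma Im_sumM (z : 'I_N -> C) (x : 'cV[C]_N) :
  complex.Im (\sum_i z i * x i 0) =
  \sum_p (if p.2 then complex.Re (z p.1) else complex.Im (z p.1)) * re_im x p.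
Proof.
rewrite big_pair_bool raddf_sum /=; apply: eq_bigr => i _; rewrite /re_im /=.
by case: (z i) (x i 0) => [a b] [c d] /=; ring.
Qed.

(* Applied to alpha = g_1 - g_3 and beta = g_2 - g_3: the three complex numbers
   g_1 x, g_2 x, g_3 x lie on a real line. *)
Definition collinear_forms (alpha beta : 'I_N -> C) (x : 'cV[C]_N) : Prop :=
  complex.Im (conjc (\sum_i alpha i * x i 0) * \sum_i beta i * x i 0) = 0.

(** In real coordinates the area is a quadric. Its leading coefficient in the imaginary part of the
    entry [k j] is the area spanned by the two coefficients there, which is assumed nonzero. *)
Lemma cnull_bigcup_collinear_forms (k : nat -> 'I_N) (alpha beta : nat -> 'I_N -> C) :
  (forall j, complex.Im (conjc (alpha j (k j)) * beta j (k j)) != 0) ->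
  cnull (fun x => exists j, collinear_forms (alpha j) (beta j) x).
Proof.
move=> ab0.
pose re (z : 'I_N -> C) (p : 'I_N * bool) :=
  if p.2 then - complex.Im (z p.1) else complex.Re (z p.1).
pose im (z : 'I_N -> C) (p : 'I_N * bool) :=
  if p.2 then complex.Re (z p.1) else complex.Im (z p.1).
have := @box_null_cnull (fun v => exists j : nat,
  (\sum_p re (alpha j) p * v p) * (\sum_p im (beta j) p * v p) -
  (\sum_p im (alpha j) p * v p) * (\sum_p re (beta j) p * v p) = 0).
have -> : (fun x => exists j, collinear_forms (alpha j) (beta j) x) =
  (fun x => exists j : nat,
  (\sum_p re (alpha j) p * re_im x p) * (\sum_p im (beta j) p * re_im x p) -
  (\sum_p im (alpha j) p * re_im x p) * (\sum_p re (beta j) p * re_im x p) = 0).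
  apply: boolp.funext => x; apply: boolp.propext.
  by split=> -[j jP]; exists j; move: jP; rewrite /collinear_forms Im_conjM !Re_sumM !Im_sumM.
apply; apply: (box_null_bigcup (k 0, true)) => j.
apply: (quadric_box_null (k j, true)); rewrite /re /im /=.
by move: (ab0 j); rewrite Im_conjM; apply: contra_neq => h; rewrite -[RHS]h; ring.
Qed.

(** Cramer's rule: Re (c A) = Re (c B) = 0 are two real linear equations in the real and imaginary
    parts of [c], with determinant the nonzero area up to sign. *)
Lemma Re_mul_noncollinear_eq0 (A B c : C) : complex.Im (conjc A * B) != 0 ->
  c * A + conjc (c * A) = 0 -> c * B + conjc (c * B) = 0 -> c = 0.
Proof.
rewrite Im_conjM; case: A B c => [a1 a2] [b1 b2] [p q] /= D.
move=> /eqP; rewrite eq_complex /= => /andP[/eqP h1 _].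
move=> /eqP; rewrite eq_complex /= => /andP[/eqP h2 _].
have [e1 e2] : p * a1 - q * a2 = 0 /\ p * b1 - q * b2 = 0 by split; lra.
have p0 : p * (a1 * b2 - a2 * b1) = 0.
  have -> : p * (a1 * b2 - a2 * b1) = b2 * (p * a1 - q * a2) - a2 * (p * b1 - q * b2) by ring.
  by rewrite e1 e2 !mulr0 subrr.
have q0 : q * (a1 * b2 - a2 * b1) = 0.
  have -> : q * (a1 * b2 - a2 * b1) = b1 * (p * a1 - q * a2) - a1 * (p * b1 - q * b2) by ring.
  by rewrite e1 e2 !mulr0 subrr.
move: p0 q0 => /eqP; rewrite mulf_eq0 (negbTE D) orbF => /eqP-> /eqP.
by rewrite mulf_eq0 (negbTE D) orbF => /eqP->.
Qed.

End ComplexNull.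

Section ConjugateTranspose.
Context {R : realType}.
Local Notation C := R[i].

Lemma ctrE m n (A : 'M[C]_(m, n)) i j : ctr A i j = conjc (A j i).
Proof. by rewrite /ctr !mxE. Qed.

Lemma ctrK m n (A : 'M[C]_(m, n)) : ctr (ctr A) = A.
Proof. by apply/matrixP => i j; rewrite !ctrE conjcK. Qed.

Lemma ctrM m n p (A : 'M[C]_(m, n)) (B : 'M[C]_(n, p)) : ctr (A *m B) = ctr B *m ctr A.
Proof. by rewrite /ctr map_mxM trmx_mul. Qed.

Lemma ctrD m n (A B : 'M[C]_(m, n)) : ctr (A + B) = ctr A + ctr B.
Proof. by apply/matrixP => i j; rewrite !(ctrE, mxE) rmorphD. Qed.

Lemma ctrZ m n a (A : 'M[C]_(m, n)) : ctr (a *: A) = conjc a *: ctr A.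
Proof. by apply/matrixP => i j; rewrite !(ctrE, mxE) rmorphM. Qed.

Lemma mx11_ctrE (z : 'M[C]_1) : (z *m ctr z) 0 0 = `|z 0 0| ^+ 2.
Proof. by rewrite mxE big_ord1 ctrE sqr_normc. Qed.

Lemma hpsd_rank1 N (x : 'cV[C]_N) : hpsd (x *m ctr x).
Proof.
split=> [|v]; first by rewrite ctrM ctrK.
have -> : ctr v *m (x *m ctr x) *m v = (ctr v *m x) *m ctr (ctr v *m x).
  by rewrite ctrM ctrK !mulmxA.
by rewrite mx11_ctrE exprn_ge0.
Qed.

(* For [u^* X v != 0] a suitable [l] makes the form equal to [-1] at [l *: v + u]. *)
Lemma hpsd_isotropic N (X : 'M[C]_N) (v u : 'cV[C]_N) :
  hpsd X -> (ctr v *m X *m v) 0 0 = 0 -> (ctr u *m X *m v) 0 0 = 0.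
Proof.
move=> [hX pX] v0; set p := (_ *m v) 0 0; apply/eqP/negPn/negP => p0.
have pc : (ctr v *m X *m u) 0 0 = conjc p.
  by rewrite /p -ctrE !ctrM ctrK hX mulmxA.
have q0 := pX u; set q := (_ *m u) 0 0 in q0.
have qc : conjc q = q by rewrite /q -ctrE !ctrM ctrK hX mulmxA.
(* The two cross terms of the form at [l *: v + u] are then - (q + 1) / 2 each, and q - (q + 1) =
   -1. *)
pose l := - ((q + 1) / (2 * (p * conjc p))) * conjc p.
have := pX (l *: v + u).
rewrite ctrD ctrZ !mulmxDl !mulmxDr -!scalemxAl -!scalemxAr.
have DE (A B : 'M[C]_1) : (A + B) 0 0 = A 0 0 + B 0 0 by rewrite mxE.
have ZE a (A : 'M[C]_1) : (a *: A) 0 0 = a * A 0 0 by rewrite mxE.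
rewrite !(DE, ZE) -/p -/q v0 pc.
have -> : conjc l = - ((q + 1) / (2 * (p * conjc p))) * p.
  rewrite /l rmorphM rmorphN fmorph_div rmorphD rmorph1 /= qc conjcK.
  by rewrite !rmorphM rmorph_nat /= conjcK [conjc p * p]mulrC.
have pc0 : conjc p != 0 by rewrite conjc_eq0.
rewrite /l (_ : _ + _ = -1) ?oppr_ge0 ?ler10 //.
by field; rewrite pc0 p0.
Qed.

End ConjugateTranspose.

(** * Short-time Fourier measurements *)

Lemma conjcX (R : rcfType) (z : R[i]) n : conjc (z ^+ n) = conjc z ^+ n.
Proof. exact: rmorphXn. Qed.

Lemma conjcM (R : rcfType) (a b : R[i]) : conjc (a * b) = conjc a * conjc b.
Proof. exact: rmorphM. Qed.

Section RootOfUnity.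
Context {R : realType} (N : nat).
Local Notation C := R[i].

Definition theta : R := 2 * pi / N%:R.
Definition zeta : C := (cos theta +i* sin theta)%C.

Lemma zetaX n : zeta ^+ n = (cos (theta *+ n) +i* sin (theta *+ n))%C.
Proof.
elim: n => [|n IH]; first by rewrite expr0 mulr0n cos0 sin0.
rewrite exprS IH mulrS cosD sinD /zeta; apply/eqP; rewrite eq_complex /=.
by apply/andP; split; apply/eqP => //; ring.
Qed.

Lemma fvecE m (n : 'I_N) : fvec R N m n 0 = zeta ^+ (m * n).
Proof. by rewrite mxE zetaX -[theta *+ _]mulr_natr /theta [2 * pi / _ * _]mulrAC. Qed.

Lemma zeta_mul_conj : zeta * conjc zeta = 1.
Proof.
rewrite /zeta; apply/eqP; rewrite eq_complex /=.
by rewrite mulrN opprK -!expr2 cos2Dsin2 mulrN mulrC addNr !eqxx.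
Qed.

Lemma conj_zetaXK n : conjc zeta ^+ n * zeta ^+ n = 1.
Proof. by rewrite -exprMn mulrC zeta_mul_conj expr1n. Qed.

Lemma sin_theta_gt0 : (2 < N)%N -> 0 < sin theta.
Proof.
move=> N2; apply: sin_gt0_pi; have p0 := pi_gt0 R.
have N0 : 0 < (N%:R : R) by rewrite ltr0n; apply: leq_trans N2.
rewrite /theta divr_gt0 ?mulr_gt0 //= ltr_pdivrMr // mulrC ltr_pM2l //.
by rewrite ltr_nat.
Qed.

(* The expression equals [zeta - zeta^2 - zeta^-1 + 1], whose imaginary part is
   [2 sin theta (1 - cos theta)]. *)
Lemma zeta_noncollinear : (2 < N)%N ->
  complex.Im (conjc (zeta - zeta ^+ 3) * (zeta ^+ 2 - zeta ^+ 3)) != 0.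
Proof.
move=> /sin_theta_gt0 s0.
have -> : conjc (zeta - zeta ^+ 3) * (zeta ^+ 2 - zeta ^+ 3) =
          zeta - zeta ^+ 2 - conjc zeta + 1.
  have inv_expand (a b : C) : a * b = 1 ->
      (b - b ^+ 3) * (a ^+ 2 - a ^+ 3) = a - a ^+ 2 - b + 1.
    move=> ab; have -> : (b - b ^+ 3) * (a ^+ 2 - a ^+ 3) =
      a * (a * b) - a ^+ 2 * (a * b) - b * (a * b) ^+ 2 + (a * b) ^+ 3 by ring.
    by rewrite ab !(expr1n, mulr1).
  rewrite rmorphB rmorphXn; exact: inv_expand zeta_mul_conj.
have -> : complex.Im (zeta - zeta ^+ 2 - conjc zeta + 1) = 2 * sin theta * (1 - cos theta).
  by rewrite expr2 /zeta /=; ring.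
have c1 : cos theta != 1.
  apply/eqP => c1; have := cos2Dsin2 theta; rewrite c1 expr1n.
  by move: (exprn_gt0 2 s0); lra.
by rewrite !mulf_neq0 ?pnatr_eq0 ?(gt_eqF s0) // subr_eq0 eq_sym.
Qed.

End RootOfUnity.

Lemma wext_nat (R : realType) W (w : 'I_W -> R[i]) j (jW : (j < W)%N) :
  wext w (j%:Z) = w (Ordinal jW).
Proof. by rewrite /wext insubT. Qed.

Lemma wext_lt0 (R : realType) W (w : 'I_W -> R[i]) (k : int) : k < 0 -> wext w k = 0.
Proof. by case: k. Qed.

(** * Inductive recovery of the matrix from its measurements *)

Section Recovery.
Context {R : realType} {N W M : nat} {w : 'I_W -> R[i]}.
Local Notation C := R[i].
Hypotheses (W2 : (2 <= W)%N) (M3 : (3 <= M)%N) (w0 : forall n, w n != 0).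

Definition stft_row (m r : nat) : 'rV[C]_N := ctr (fvec R N m) *m Wmat N w r.

Lemma stft_rowE m r (n : 'I_N) :
  stft_row m r 0 n = conjc (zeta N) ^+ (m * n) * wext w (r%:Z - (n : nat)%:Z).
Proof.
by rewrite /stft_row /Wmat mul_mx_diag mxE ctrE fvecE [X in _ * X]mxE conjcX.
Qed.

(** With y the row [stft_row m r], the measurement matrix is the rank one product y^* y, and the
    trace is cyclic. *)
Lemma trace_stft_row m r (X : 'M[C]_N) :
  \tr (ctr (Wmat N w r) *m fvec R N m *m ctr (fvec R N m) *m Wmat N w r *m X) =
  (stft_row m r *m X *m ctr (stft_row m r)) 0 0.
Proof.
have -> : ctr (Wmat N w r) *m fvec R N m *m ctr (fvec R N m) *m Wmat N w r *m X =
  ctr (stft_row m r) *m (stft_row m r *m X).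
  by rewrite /stft_row ctrM ctrK !mulmxA.
by rewrite mxtrace_mulC /mxtrace big_ord1.
Qed.

Lemma Zw_stft_row (x0 : 'cV[C]_N) m r :
  Zw w x0 m r = (stft_row m r *m (x0 *m ctr x0) *m ctr (stft_row m r)) 0 0.
Proof.
have -> : stft_row m r *m (x0 *m ctr x0) *m ctr (stft_row m r) =
  (stft_row m r *m x0) *m ctr (stft_row m r *m x0) by rewrite ctrM !mulmxA.
by rewrite mx11_ctrE.
Qed.

Lemma stft_feasible_rank1 (x0 : 'cV[C]_N) : stft_feasible M w x0 (x0 *m ctr x0).
Proof. by move=> m r _ _; rewrite trace_stft_row -Zw_stft_row. Qed.

(** Among the pairs of indices at most r, only those involving r survive: the diagonal one, the
    column above it, and the row to its left, which is the conjugate of the column. *)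
Lemma sum_herm_corner (D : 'M[C]_N) (y : 'rV[C]_N) (r : 'I_N) :
  (forall i j : 'I_N, (i < r)%N -> (j < r)%N -> D i j = 0) ->
  (forall i : 'I_N, (r < i)%N -> y 0 i = 0) ->
  (forall i j, D j i = conjc (D i j)) ->
  (y *m D *m ctr y) 0 0 =
  D r r * (y 0 r * conjc (y 0 r)) +
  ((\sum_(i < N | (i < r)%N) y 0 i * D i r) * conjc (y 0 r) +
   conjc ((\sum_(i < N | (i < r)%N) y 0 i * D i r) * conjc (y 0 r))).
Proof.
move=> D0 y0 Dh.
have split_r (f : 'I_N -> C) : (forall i : 'I_N, (r < i)%N -> f i = 0) ->
    \sum_i f i = f r + \sum_(i < N | (i < r)%N) f i.
  move=> f0; rewrite (bigD1 r) //=; congr (_ + _).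
  rewrite (bigID (fun i : 'I_N => (i < r)%N)) /= [X in _ + X]big1 ?addr0.
    by apply: eq_bigl => i; rewrite -(inj_eq val_inj) /=; case: ltngtP.
  by move=> i /andP[ir]; rewrite -leqNgt leq_eqVlt eq_sym (inj_eq val_inj) (negbTE ir) => /f0.
rewrite mxE split_r => [|i /y0 yi]; last by rewrite ctrE yi conjc0 mulr0.
have rowE j : (y *m D) 0 j = y 0 r * D r j + \sum_(i < N | (i < r)%N) y 0 i * D i j.
  by rewrite mxE split_r // => i /y0->; rewrite mul0r.
have rowl (j : 'I_N) : (j < r)%N -> (y *m D) 0 j * ctr y j 0 = conjc (y 0 j * D j r) * y 0 r.
  move=> jr; rewrite rowE big1 ?addr0 => [|i ir]; last by rewrite D0 ?mulr0.
  by rewrite ctrE rmorphM (Dh j r); ring.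
rewrite (eq_bigr _ rowl) -mulr_suml -rmorph_sum rowE ctrE rmorphM /= conjcK.
by ring.
Qed.

(* The coefficients of g_m as a linear form in x0. *)
Definition gcoef (r m : nat) (i : 'I_N) : C :=
  if (i < r)%N then
    stft_row m r 0 i * conjc (conjc (zeta N) ^+ (m * r))
  else 0.

Definition degenerate (r : nat) : 'cV[C]_N -> Prop :=
  collinear_forms (fun i => gcoef r 1 i - gcoef r 3 i)
                  (fun i => gcoef r 2 i - gcoef r 3 i).

(** At the index r - 1 the phase is that of lag 1 and the window value is w[1], which exists because
    W >= 2. *)
Lemma gcoef_last (r m : nat) (k : 'I_N) (W1 : (1 < W)%N) :
  r = k.+1 -> gcoef r m k = zeta N ^+ m * w (Ordinal W1).
Proof.
move=> rk; rewrite /gcoef rk ltnSn stft_rowE.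
have -> : (k.+1)%:Z - (k : nat)%:Z = 1%:Z by rewrite -addn1 PoszD addrAC subrr add0r.
rewrite (wext_nat _ _ _ _ W1) conjcX conjcK mulnS exprD -[RHS]mul1r -(conj_zetaXK N (m * k)).
by set a := conjc (zeta N) ^+ (m * k); set b := zeta N ^+ (m * k); ring.
Qed.

(** The common factor w[1] scales the area by |w[1]|^2, which leaves the area of
    [zeta_noncollinear]. *)
Lemma gcoef_noncollinear (r : nat) (k : 'I_N) : (2 < N)%N -> r = k.+1 ->
  complex.Im (conjc (gcoef r 1 k - gcoef r 3 k) * (gcoef r 2 k - gcoef r 3 k)) != 0.
Proof.
move=> N2 rk; rewrite !(gcoef_last _ _ _ W2 rk) -!mulrBl.
set u := w _; have u0 : u != 0 by apply: w0.
rewrite rmorphM mulrACA expr1 [conjc u * u]mulrC -sqr_normc.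
have Im_realM (s z : C) : complex.Im s = 0 -> s != 0 -> complex.Im z != 0 ->
    complex.Im (s * z) != 0.
  case: s z => [a b] [c d] /= -> a0 d0; rewrite mul0r addr0 mulf_neq0 //.
  by apply: contra_neq a0 => ->.
rewrite mulrC; apply: Im_realM; last exact: zeta_noncollinear.
  by rewrite sqr_normc; case: (u) => a b /=; ring.
by rewrite expf_neq0 // normr_eq0.
Qed.

(** The alternative c = 0 serves the first step r = 0, where no earlier index constrains [c]. *)
Lemma recovery_step (r : 'I_N) (D : 'M[C]_N) (x : 'cV[C]_N) (c : C) :
  (forall i j : 'I_N, (i < r)%N -> (j < r)%N -> D i j = 0) ->
  (forall i j, D j i = conjc (D i j)) ->
  (forall m, (1 <= m <= 3)%N -> (stft_row m r *m D *m ctr (stft_row m r)) 0 0 = 0) ->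
  (forall i : 'I_N, (i < r)%N -> D i r = x i 0 * c) ->
  c = 0 \/ ~ degenerate r x ->
  D r r = 0 /\ c = 0.
Proof.
move=> D0 Dh meas Dc nd.
have W0 : (0 < W)%N by apply: leq_trans W2.
set u := w (Ordinal W0); have u0 : u != 0 by apply: w0.
pose g m := \sum_i gcoef r m i * x i 0.
have eqm m : (1 <= m <= 3)%N ->
    D r r * (u * conjc u) + (c * conjc u * g m + conjc (c * conjc u * g m)) = 0.
  move=> /meas; rewrite (sum_herm_corner _ _ r) // => [|i ri]; last first.
    by rewrite stft_rowE wext_lt0 ?mulr0 // subr_lt0 ltz_nat.
  have yr : stft_row m r 0 r = conjc (zeta N) ^+ (m * r) * u.
    by rewrite stft_rowE subrr (wext_nat _ _ _ _ W0).
  have -> : (\sum_(i < N | (i < r)%N) stft_row m r 0 i * D i r) * conjc (stft_row m r 0 r) =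
            c * conjc u * g m.
    rewrite /g big_mkcond /= mulr_suml mulr_sumr; apply: eq_bigr => i _.
    rewrite /gcoef; case: ifP => ir; last by rewrite !(mul0r, mulr0).
    by rewrite Dc // yr conjcM; ring.
  (* The phase of y at r has modulus 1 and drops out of the diagonal term. *)
  rewrite yr conjcM conjcX conjcK mulrACA conj_zetaXK mul1r.
  by [].
have c0 : c = 0.
  case: nd => // nd; have : c * conjc u = 0.
    apply: (Re_mul_noncollinear_eq0 (\sum_i (gcoef r 1 i - gcoef r 3 i) * x i 0)
                             (\sum_i (gcoef r 2 i - gcoef r 3 i) * x i 0)).
    - by apply/eqP.
    (* Subtracting the equation for m = 3 eliminates the unknown D r r. *)
    - under eq_bigr do rewrite mulrBl.
      rewrite big_split sumrN -/(g 1) -/(g 3) /= mulrBr rmorphB /=.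
      by rewrite -[RHS](subrr 0) -{1}(eqm 1%N) // -(eqm 3%N) //; ring.
    under eq_bigr do rewrite mulrBl.
    rewrite big_split sumrN -/(g 2) -/(g 3) /= mulrBr rmorphB /=.
    by rewrite -[RHS](subrr 0) -{1}(eqm 2%N) // -(eqm 3%N) //; ring.
  by move=> /eqP; rewrite mulf_eq0 conjc_eq0 (negbTE u0) orbF => /eqP.
split=> //; have := eqm 1%N erefl.
rewrite c0 !mul0r conjc0 !addr0 => /eqP.
by rewrite !mulf_eq0 conjc_eq0 (negbTE u0) !orbF => /eqP.
Qed.

(** The vector v = conj x[j] e_i - conj x[i] e_j is isotropic for the rank one block, so X v = 0 by
    [hpsd_isotropic]; the claim is the conjugate of row r of X v. *)
Lemma hpsd_rank1_block (X : 'M[C]_N) (x : 'cV[C]_N) (i j r : 'I_N) : hpsd X ->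
  X i i = x i 0 * conjc (x i 0) -> X i j = x i 0 * conjc (x j 0) ->
  X j i = x j 0 * conjc (x i 0) -> X j j = x j 0 * conjc (x j 0) ->
  x j 0 * X i r = x i 0 * X j r.
Proof.
move=> hX Xii Xij Xji Xjj.
pose e k : 'cV[C]_N := delta_mx k 0.
have eXe k l : (ctr (e k) *m X *m e l) 0 0 = X k l.
  have -> : ctr (e k) = delta_mx 0 k.
    by apply/matrixP => a b; rewrite ctrE !mxE conjc_nat andbC.
  by rewrite -rowE -colE !mxE.
have DE (A B : 'M[C]_1) : (A + B) 0 0 = A 0 0 + B 0 0 by rewrite mxE.
have ZE a (A : 'M[C]_1) : (a *: A) 0 0 = a * A 0 0 by rewrite mxE.
pose v := conjc (x j 0) *: e i + (- conjc (x i 0)) *: e j.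
have ev (u : 'cV[C]_N) : (ctr u *m X *m v) 0 0 =
  conjc (x j 0) * (ctr u *m X *m e i) 0 0 - conjc (x i 0) * (ctr u *m X *m e j) 0 0.
  by rewrite /v mulmxDr -!scalemxAr DE !ZE mulNr.
have ve (u : 'cV[C]_N) : (ctr v *m X *m u) 0 0 =
  x j 0 * (ctr (e i) *m X *m u) 0 0 - x i 0 * (ctr (e j) *m X *m u) 0 0.
  by rewrite /v ctrD !ctrZ !mulmxDl -!scalemxAl DE !ZE rmorphN /= !conjcK mulNr.
have : (ctr (e r) *m X *m v) 0 0 = 0.
  apply: hpsd_isotropic => //.
  by rewrite ev !ve !eXe Xii Xij Xji Xjj; ring.
rewrite ev !eXe => /(congr1 (@conjc R)); rewrite conjc0 rmorphB !rmorphM /= !conjcK.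
have hc a b : conjc (X a b) = X b a by rewrite -ctrE (proj1 hX).
by rewrite !hc => /eqP; rewrite subr_eq0 => /eqP.
Qed.

Lemma stft_unique (x0 : 'cV[C]_N) (X : 'M[C]_N) :
  (forall n, x0 n 0 != 0) ->
  (forall r, (0 < r < N)%N -> ~ degenerate r x0) ->
  hpsd X -> stft_feasible M w x0 X -> X = x0 *m ctr x0.
Proof.
move=> x00 nd hX feas.
pose D := X - x0 *m ctr x0.
have x0E i j : (x0 *m ctr x0) i j = x0 i 0 * conjc (x0 j 0).
  by rewrite mxE big_ord1 ctrE.
have DE i j : D i j = X i j - x0 i 0 * conjc (x0 j 0) by rewrite !mxE -x0E mxE.
have hc a b : conjc (X a b) = X b a by rewrite -ctrE (proj1 hX).
have Dh i j : D j i = conjc (D i j).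
  by rewrite !DE rmorphB rmorphM /= hc conjcK mulrC.
have meas m (r : 'I_N) : (1 <= m <= 3)%N -> (stft_row m r *m D *m ctr (stft_row m r)) 0 0 = 0.
  move=> /andP[m1 m3]; have := feas m r.
  rewrite trace_stft_row Zw_stft_row m1 (leq_trans m3 M3) => /(_ erefl).
  move=> H; rewrite /D mulmxBr mulmxBl [LHS]mxE [X in _ + X]mxE H ?subrr //.
  (* Shifts r < N are admissible since W >= 1 gives N <= N + W - 1. *)
  by rewrite -addnBA ?(leq_trans (ltn_ord r)) ?leq_addr // ltnW.
suff : forall r, (r <= N)%N -> forall i j : 'I_N, (i < r)%N -> (j < r)%N -> D i j = 0.
  move=> /(_ N (leqnn _)) D0; apply/eqP; rewrite -subr_eq0; apply/eqP/matrixP => i j.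
  by rewrite [RHS]mxE; apply: D0.
elim=> [//|r IH] rN; have {IH} D0 := IH (ltnW rN).
pose ro := Ordinal rN.
have XE (i j : 'I_N) : (i < r)%N -> (j < r)%N -> X i j = x0 i 0 * conjc (x0 j 0).
  by move=> ir jr; apply/eqP; rewrite -subr_eq0 -DE D0.
have [c [cD cn]] : exists c, (forall i : 'I_N, (i < r)%N -> D i ro = x0 i 0 * c) /\
                             (c = 0 \/ ~ degenerate ro x0).
  case: (posnP r) => [r0|r0]; first by exists 0; split; [move=> i; rewrite r0 | left].
  pose z := Ordinal (ltn_trans r0 rN).
  (* The ratio X i r / x0[i] is the same for all i < r, so it is read off at i = 0; passing from X
     to D subtracts conj x0[r]. *)
  exists (X z ro / x0 z 0 - conjc (x0 ro 0)); split; last by right; apply: nd; rewrite /= r0.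
  move=> i ir; rewrite DE mulrBr; congr (_ - _).
  have := hpsd_rank1_block _ _ i z ro hX
    (XE i i ir ir) (XE i z ir r0) (XE z i r0 ir) (XE z z r0 r0).
  by move=> h; rewrite mulrA -h mulrC mulKf.
have [Drr c0] := recovery_step ro D x0 c D0 Dh (fun m => meas m ro) cD cn.
have Dr (i : 'I_N) : (i < r)%N -> D i ro = 0 by move=> /cD->; rewrite c0 mulr0.
have below (i : 'I_N) : (i < r.+1)%N -> i = ro \/ (i < r)%N.
  by rewrite ltnS leq_eqVlt => /predU1P[ir|]; [left; apply: val_inj | right].
move=> i j /below[->|ir] /below[->|jr]; first exact: Drr.
- by rewrite Dh Dr // conjc0.
- exact: Dr.
exact: D0.
Qed.

End Recovery.

Theorem theorem3 (R : realType) (N W M : nat) (w : 'I_W -> R[i]) :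
  (0 < N)%N -> (0 < W)%N -> (0 < M)%N ->
  (forall n, w n != 0) ->
  (2 <= W)%N -> (W.*2 <= N)%N ->
  (4 <= M)%N -> (M <= N)%N ->
  exists E : 'cV[R[i]]_N -> Prop, cnull E /\
    forall x0 : 'cV[R[i]]_N, (forall n, x0 n 0 != 0) -> ~ E x0 ->
      (hpsd (x0 *m ctr x0) /\ stft_feasible M w x0 (x0 *m ctr x0)) /\
      (forall X : 'M[R[i]]_N, hpsd X -> stft_feasible M w x0 X -> X = x0 *m ctr x0).
Proof.
move=> N0 _ _ w0 W2 _ M4 MN.
have N2 : (2 < N)%N by apply: leq_trans MN; apply: leq_trans M4.
(* Numbers j >= N fall back to the index 0, so a family over [nat] covers all steps; step [(k j).+1]
   has [k j] as its last earlier index. *)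
pose k (j : nat) : 'I_N := insubd (Ordinal N0) j.
exists (fun x => exists j, @degenerate R N W w (k j).+1 x); split.
  apply: (cnull_bigcup_collinear_forms k) => j.
  exact: gcoef_noncollinear.
move=> x0 x00 nE; split; first by split; [apply: hpsd_rank1 | apply: stft_feasible_rank1].
move=> X; apply: stft_unique => //; first exact: leq_trans M4.
move=> [//|r] /andP[_ rN] d; apply: nE; exists r.
by rewrite /k val_insubd (ltnW rN).
Qed.
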